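(* Consider the random walk with absorption on $\{0,1,\dots,N\}$ with parameters $p_i,q_i,r_i,s_i$, started in $i_0$, and let $x_j$ be the expected number of arrivals in $j$ when starting in $i_0$. **Case $0<i_0<N$.** Then $$x_{i_0}=\left[1-r_{i_0}+p_{i_0-1}\theta_{-i_0}\frac{A_{i_0-1}^{(2-i_0)}(\rho,\theta)}{A_{i_0}^{(1-i_0)}(\rho,\theta)}+q_{i_0+1}\mu_{i_0}\frac{A_{N-i_0-1}^{(i_0+2)}(\lambda,\mu)}{A_{N-i_0}^{(i_0+1)}(\lambda,\mu)}\right]^{-1};$$ for $k=0,1,\dots,N-i_0$, $$x_{i_0+k+1}=\mu_{i_0}x_{i_0}\left[A_{k-1}^{(i_0+2)}(\lambda,\mu)A_{N-i_0}^{(i_0+1)}(\lambda,\mu)-A_{N-i_0-1}^{(i_0+2)}(\lambda,\mu)A_k^{(i_0+1)}(\lambda,\mu)\right]\left[A_{N-i_0}^{(i_0+1)}(\lambda,\mu)\right]^{-1};$$ and for $k=0,1,\dots,i_0-1$, $$x_{i_0-(k+1)}=\theta_{-i_0}x_{i_0}\left[A_{k-1}^{(2-i_0)}(\rho,\theta)A_{i_0}^{(1-i_0)}(\rho,\theta)-A_{i_0-1}^{(2-i_0)}(\rho,\theta)A_k^{(1-i_0)}(\rho,\theta)\right]\left[A_{i_0}^{(1-i_0)}(\rho,\theta)\right]^{-1}.$$ **Case $i_0=0$.** With $A_i^{(m)}=A_i^{(m)}(\lambda,\mu)$, $$x_0=\frac{A_{N}^{(1)}}{q_1A_{N+1}^{(0)}},\qquad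 x_i=\frac{A_{N}^{(1)}A_i^{(0)}-A_{i-1}^{(1)}A_{N+1}^{(0)}}{q_1A_{N+1}^{(0)}}\quad(i=1,\dots,N).$$
   Context: Random walk: in every state $i\in\{0,1,\dots,N\}$ there are one-step probabilities $p_i$ (move to $i+1$), $q_i$ (move to $i-1$), $r_i$ (stay in $i$) and $s_i$ (absorption in state $i$), with $p_i+q_i+r_i+s_i=1$ for $0\le i\le N$, and $q_0=p_N=0$. The starting point is $i_0$, $0\le i_0\le N$. With $p_{ij}^{(k)}$ the probability that the system is in state $j$ after $k$ steps when started in $i$, the expected number of arrivals in $j$ is $x_j=\sum_{k=0}^\infty p_{i_0,j}^{(k)}$. Fibonacci numbers: $f_0=f_1=1$, $f_{n+1}=f_n+f_{n-1}$ for $n\ge1$. Fibonacci matrices: let $m\in\mathbb Z$ and let $\lambda_m,\lambda_{m+1},\dots$ and $\mu_m,\mu_{m+1},\dots$ be given (as many as needed). Put $F_0=[1]$, $F_1=[\lambda_m]$. For $n\ge 1$, $F_{n+1}$ is the matrix with $n+1$ rows and $f_{n+1}$ columns defined recursively as follows. In columns $1,\dots,f_n$: rows $1,\dots,n$ form the matrix $F_n$, and every entry of row $n+1$ is $\lambda_{m+n}$. In columns $f_n+1,\dots,f_{n+1}$ (there are $f_{n-1}$ of them): rows $1,\dots,n-1$ form the matrix $F_{n-1}$ (for $n=1$ there are no such rows), every entry of row $n$ is $1$, and every entry of row $n+1$ is $\mu_{m+n-1}$. Since $F_n$ is the upper left block of $F_{n+1}$, the $(i,j)$ entry does not depend on which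 matrix containing that position is used; it is denoted $\tau_{ij}^{(m)}$. Notation: $A_i^{(m)}(\lambda,\mu)=\sum_{j=1}^{f_i}\prod_{k=1}^{i}\tau_{kj}^{(m)}$ for $i\ge1$, $A_0^{(m)}=1$, $A_{-1}^{(m)}=0$. (Thus $A_i^{(m)}(\lambda,\mu)$ involves only $\lambda_m,\dots,\lambda_{m+i-1}$ and $\mu_m,\dots,\mu_{m+i-2}$.) $A_i^{(m)}(\rho,\theta)$ is the same expression with $\lambda,\mu$ replaced by $\rho,\theta$. Here $$\lambda_i=\frac{1-r_i}{q_{i+1}},\qquad \mu_i=-\frac{p_i}{q_{i+2}}$$ (used with nonnegative indices, $\lambda_i$ for $i\le N$ and $\mu_i$ for $i\le N-1$), and, with nonpositive indices, $$\rho_{-i}=\frac{1-r_i}{p_{i-1}}\ (i\ge 0),\qquad \theta_{-i}=-\frac{q_i}{p_{i-2}}\ (i\ge1).$$ Artificial states: in the case $0<i_0<N$ two artificial states $N+1$ and $-1$ are introduced with $x_{N+1}=0$, $x_{-1}=0$, $q_{N+1}>0$, $p_{-1}>0$ ($x_{N+1}$ is the value appearing for $k=N-i_0$); in the case $i_0=0$ only the artificial state $N+1$ is introduced, with $x_{N+1}=0$, $q_{N+1}>0$. *)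

(* Defs.v *)
From HB Require Import structures.
From mathcomp Require Import all_boot all_order all_algebra.
From mathcomp Require Import all_classical all_reals all_analysis.

Set Implicit Arguments.
Unset Strict Implicit.
Unset Printing Implicit Defensive.

Import Order.TTheory GRing.Theory Num.Theory.

Local Open Scope ring_scope.

(* Random walk with absorption on {0, ..., N}.  The parameters are indexed by
   int so that the artificial values q (N + 1) and p (- 1) are available. *)

(* One-step transitions between the non-absorbed states.  A walk absorbed in i
   (probability s i) has left the system, so row i sums to 1 - s i. *)
Definition step (R : realType) (N : nat) (p q r : int -> R) : 'M[R]_N.+1 :=
  \matrix_(i, j) (if j == i.+1 :> nat then p i%:Z
                  else if j.+1 == i :> nat then q i%:Z
                  else if i == j then r i%:Z else 0).

(* x_j: expected number of arrivals in j starting from i0.  It is 0 at every j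
   outside {0, ..., N}, in particular at the artificial states -1 and N + 1. *)
Definition arrivals (R : realType) (N : nat) (p q r : int -> R)
    (i0 : 'I_N.+1) (j : int) : \bar R :=
  if j is Posz n then
    if insub n is Some j' then
      (\sum_(0 <= k <oo) ((step N p q r ^+ k) i0 j')%:E)%E
    else 0%E
  else 0%E.

(* From every state, some state in which absorption is possible is
   accessible. *)
Definition absorbing (R : realType) (N : nat) (p q r s : int -> R) : Prop :=
  forall i : 'I_N.+1, exists2 j : 'I_N.+1,
    connect [rel a b : 'I_N.+1 | 0 < step N p q r a b] i j & 0 < s j%:Z.

Record random_walk (R : realType) (N : nat) (p q r s : int -> R) : Prop :=
  RandomWalk {
    walk_ge0 : forall i : int, 0 <= i <= N%:Z ->
      [/\ 0 <= p i, 0 <= q i, 0 <= r i & 0 <= s i];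
    walk_sum1 : forall i : int, 0 <= i <= N%:Z -> p i + q i + r i + s i = 1;
    walk_q0 : q 0 = 0;
    walk_pN : p N%:Z = 0;
    walk_absorbing : absorbing N p q r s
  }.

Fixpoint fib (n : nat) : nat :=
  match n with
  | 0 => 1
  | n1.+1 => match n1 with 0 => 1 | n2.+1 => fib n1 + fib n2 end
  end.

(* The Fibonacci matrix F_n for the index m, with n rows and fib n columns.
   F_0 is taken with 0 rows and 1 column: its entry is never used, since F_2
   has no rows coming from F_0.  In F_(n+2), the matches on unlift ord_max i
   separate the last row, the last but one row and the rows above. *)
Fixpoint fibmx (R : realType) (lam mu : int -> R) (m : int) (n : nat) :
    'M[R]_(n, fib n) :=
  match n return 'M[R]_(n, fib n) with
  | 0 => const_mx 1
  | n1.+1 =>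
    match n1 return 'M[R]_(n1, fib n1) -> 'M[R]_(n1.+1, fib n1.+1) with
    | 0 => fun _ => const_mx (lam m)
    | n2.+1 => fun F1 : 'M[R]_(n2.+1, fib n2.+1) =>
      \matrix_(i < n2.+2, j < fib n2.+1 + fib n2)
        match fintype.split j with
        | inl j1 =>
          if unlift ord_max i is Some i1 then F1 i1 j1
          else lam (m + n2.+1%:Z)
        | inr j2 =>
          if unlift ord_max i is Some i1 then
            if unlift ord_max i1 is Some i2 then fibmx lam mu m n2 i2 j2
            else 1
          else mu (m + n2%:Z)
        end
    end (fibmx lam mu m n1)
  end.

(* A lam mu m i is A_i^(m)(lam, mu), for i >= -1. *)
Definition A (R : realType) (lam mu : int -> R) (m i : int) : R :=
  match i with
  | Posz 0 => 1
  | Posz n => \sum_(j < fib n) \prod_(k < n) fibmx lam mu m n k j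
  | Negz _ => 0
  end.

Section Coefficients.
Variables (R : realType) (p q r : int -> R).

Definition lambda_ (i : int) : R := (1 - r i) / q (i + 1).
Definition mu_ (i : int) : R := - (p i / q (i + 2)).

(* rho_ (- i) = (1 - r i) / p (i - 1), theta_ (- i) = - (q i / p (i - 2)) *)
Definition rho_ (i : int) : R := (1 - r (- i)) / p (- i - 1).
Definition theta_ (i : int) : R := - (q (- i) / p (- i - 2)).

End Coefficients.

(* Main.v *)
(* The matrix P of transitions between non-absorbed states is substochastic and
   absorption is accessible from everywhere, so G = sum_k P^k is finite and
   equals (1 - P)^-1, and row i0 of G, which is x, is the unique solution of
   x_j = delta_(i0,j) + p_(j-1) x_(j-1) + r_j x_j + q_(j+1) x_(j+1) with
   x_(-1) = x_(N+1) = 0.  The column structure of the Fibonacci matrices gives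
   A_(n+1) = lambda_(m+n) A_n + mu_(m+n-1) A_(n-1), so on each side of i0 the
   balance equations are second order recurrences solved by the A's, and the
   boundary value 0 fixes the solution in terms of x_i0; the balance equation at
   i0 then gives x_i0.  If a denominator vanished, the A's would give a nonzero
   w supported on one side of i0 with w (1 - P) = c e_i0, that is, a multiple of
   row i0 of G that vanishes at i0, while G_(i0,i0) > 0; for i0 = 0 they would
   give a nonzero w with w (1 - P) = 0. *)
Require Import Defs.
From HB Require Import structures.
From mathcomp Require Import all_boot all_order all_algebra.
From mathcomp Require Import all_classical all_reals all_analysis.
From mathcomp Require Import zify ring.

Set Implicit Arguments.
Unset Strict Implicit.
Unset Printing Implicit Defensive.

Import Order.TTheory GRing.Theory Num.Theory.
Import numFieldNormedType.Exports.

Local Open Scope ring_scope.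

(** * Three-term recurrences for the A's *)

(** The columns of [fibmx] form two blocks: the previous matrix with a further factor [lam], and the
    one before it with further factors 1 and [mu]. At [j = 0] the second block is absent, matching
    the value 0 of [A] at -1. *)
Lemma A_rec (R : realType) (lam mu : int -> R) (m j : int) : 0 <= j ->
  A lam mu m (j + 1) =
  lam (m + j) * A lam mu m j + mu (m + j - 1) * A lam mu m (j - 1).
Proof.
have A_nat n : A lam mu m n%:Z =
    \sum_(j < fib n) \prod_(k < n) fibmx lam mu m n k j.
  by case: n => //; rewrite big_ord_recl big_ord0 big_ord0 addr0.
case: j => // -[|n] _.
  rewrite !addr0 mulr0 addr0 mulr1 -[0 + 1]/(1%N%:Z) A_nat.
  by rewrite big_ord_recl big_ord0 big_ord_recl big_ord0 mulr1 addr0 /= mxE.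
have -> : n.+1%:Z + 1 = n.+2%:Z by lia.
have -> : n.+1%:Z - 1 = n%:Z by lia.
have -> : m + n.+1%:Z - 1 = m + n%:Z by lia.
have wE (i : nat) (l : 'I_i) : widen_ord (leqnSn i) l = lift ord_max l.
  by apply/val_inj/esym/lift_max.
rewrite !A_nat [fib n.+2]/(fib n.+1 + fib n)%N big_split_ord !mulr_sumr.
congr (_ + _); apply: eq_bigr => k _.
  rewrite big_ord_recr mulrC /= mxE (unsplitK (inl k)) unlift_none.
  congr (_ * _); apply: eq_bigr => l _.
  by rewrite mxE (unsplitK (inl k)) wE liftK.
rewrite big_ord_recr mulrC /= mxE (unsplitK (inr k)) unlift_none.
rewrite big_ord_recr /= mxE (unsplitK (inr k)).
rewrite wE liftK unlift_none mulr1; congr (_ * _); apply: eq_bigr => l _.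
by rewrite mxE (unsplitK (inr k)) !wE !liftK.
Qed.

Lemma A_1 (R : realType) (lam mu : int -> R) (m : int) : A lam mu m 1 = lam m.
Proof. by rewrite -[1]add0r A_rec// addr0 /= mulr0 addr0 mulr1. Qed.

(** The coefficients of [y 1] and [y 0] are the two fundamental solutions: both obey the recurrence
    and equal 1 and 0 at [k = 0]. The range stops at [n] because the walk satisfies the recurrence
    only up to its boundary. *)
Lemma linear_recurrence_sol (R : realType) (lam mu : int -> R) (m : int)
    (n : nat) (y : nat -> R) :
  (forall k, (k < n)%N ->
     y k.+2 = lam (m + k%:Z) * y k.+1 + mu (m + k%:Z - 1) * y k) ->
  forall k, (k <= n)%N ->
    y k.+1 = A lam mu m k%:Z * y 1%N
             + mu (m - 1) * A lam mu (m + 1) (k%:Z - 1) * y 0%N.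
Proof.
move=> yS k.
(* Two consecutive values are carried along, since the recurrence has order two. *)
suff: ((k <= n)%N -> y k.+1 = A lam mu m k%:Z * y 1%N
             + mu (m - 1) * A lam mu (m + 1) (k%:Z - 1) * y 0%N) /\
      ((k < n)%N -> y k.+2 = A lam mu m k.+1%:Z * y 1%N
             + mu (m - 1) * A lam mu (m + 1) (k.+1%:Z - 1) * y 0%N) by case.
have AE j : A lam mu m (j.+2%:Z) = lam (m + j.+1%:Z) * A lam mu m j.+1%:Z
    + mu (m + j%:Z) * A lam mu m j%:Z.
  have -> : j.+2%:Z = j.+1%:Z + 1 by lia.
  rewrite A_rec//; congr (_ + mu _ * A _ _ _ _); lia.
have A'E j : A lam mu (m + 1) (j.+2%:Z - 1) =
    lam (m + j.+1%:Z) * A lam mu (m + 1) (j.+1%:Z - 1)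
    + mu (m + j%:Z) * A lam mu (m + 1) (j%:Z - 1).
  have -> : j.+2%:Z - 1 = j%:Z + 1 by lia.
  rewrite A_rec//; congr (lam _ * A _ _ _ _ + mu _ * A _ _ _ _); lia.
elim: k => [|k [IH1 IH2]]; split.
- by rewrite /= mul1r mulr0 mul0r addr0.
- by move=> /yS ->; rewrite addr0 A_1 subrr /= mulr1.
- exact: IH2.
move=> kn; rewrite yS// IH1; last by lia.
rewrite IH2; last by lia.
rewrite AE A'E.
have -> : m + k.+1%:Z - 1 = m + k%:Z by lia.
ring.
Qed.

(** Expansion at the first coefficient instead of the last: as a sequence, [A lam mu m] solves the
    recurrence of index [m + 1] with initial values 1 and [lam m]. *)
Lemma A_recl (R : realType) (lam mu : int -> R) (m : int) (k : nat) :
  A lam mu m k.+1%:Z =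
  lam m * A lam mu (m + 1) k%:Z + mu m * A lam mu (m + 2) (k%:Z - 1).
Proof.
rewrite (linear_recurrence_sol (lam := lam) (mu := mu) (m := m + 1) (n := k)
  (y := fun j => A lam mu m j%:Z))//.
  rewrite A_1 /= addrK.
  have -> : m + 1 + 1 = m + 2 by lia.
  by rewrite mulr1 mulrC.
move=> j _; have -> : j.+2%:Z = j.+1%:Z + 1 by lia.
by rewrite A_rec//; congr (lam _ * _ + mu _ * A _ _ _ _); lia.
Qed.

(** The zero at [n.+1] expresses [y 1] through [y 0]; substituting leaves a multiple of [y 0]. *)
Lemma linear_recurrence_bvp (R : realType) (lam mu : int -> R) (m : int)
    (n : nat) (y : nat -> R) :
  (forall k, (k < n)%N ->
     y k.+2 = lam (m + k%:Z) * y k.+1 + mu (m + k%:Z - 1) * y k) ->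
  y n.+1 = 0 -> A lam mu m n%:Z != 0 ->
  forall k, (k <= n)%N ->
    y k.+1 = mu (m - 1) * y 0%N *
      ((A lam mu (m + 1) (k%:Z - 1) * A lam mu m n%:Z
        - A lam mu (m + 1) (n%:Z - 1) * A lam mu m k%:Z) / A lam mu m n%:Z).
Proof.
move=> /linear_recurrence_sol ysol yn An k kn; rewrite ysol//.
move: (yn); rewrite ysol// => /eqP; rewrite addr_eq0 => /eqP y1.
have -> : y 1%N = - (mu (m - 1) * A lam mu (m + 1) (n%:Z - 1) * y 0%N) /
                  A lam mu m n%:Z by rewrite -y1 mulrC mulKf.
by field.
Qed.

(** * The Green matrix of a substochastic matrix *)

Section Substochastic.
Variables (R : realType) (N : nat) (P : 'M[R]_N.+1) (s : 'I_N.+1 -> R).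
Hypotheses (P_ge0 : forall i j, 0 <= P i j) (s_ge0 : forall i, 0 <= s i).
Hypothesis P_sum : forall i, \sum_j P i j + s i <= 1.
Hypothesis P_abs : forall i, exists2 j,
  connect [rel a b : 'I_N.+1 | 0 < P a b] i j & 0 < s j.

Lemma expmx_ge0 k i j : 0 <= (P ^+ k) i j.
Proof.
elim: k i j => [|k IH] i j; first by rewrite expr0 mxE; case: eqP.
by rewrite exprSr mxE sumr_ge0// => l _; rewrite mulr_ge0.
Qed.

(** With [a k] the mass still in the system after [k] steps, the mass absorbed next is at most
    [a k - a k.+1], so the sum telescopes below [a 0 = 1]. *)
Lemma expected_absorption n i :
  \sum_(0 <= k < n) \sum_j (P ^+ k) i j * s j <= 1.
Proof.
pose a k := \sum_j (P ^+ k) i j.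
have aS k : \sum_j (P ^+ k) i j * s j + a k.+1 <= a k.
  rewrite addrC /a; under eq_bigr do rewrite exprSr mxE.
  rewrite exchange_big -big_split ler_sum//= => l _.
  by rewrite -mulr_sumr -mulrDr ler_piMr ?expmx_ge0.
suff : \sum_(0 <= k < n) \sum_j (P ^+ k) i j * s j + a n <= 1.
  by apply: le_trans; rewrite lerDl sumr_ge0// => j _; exact: expmx_ge0.
elim: n => [|n IH].
  rewrite big_nil add0r /a expr0 (bigD1 i)//= big1 ?mxE ?eqxx ?addr0// => j ji.
  by rewrite mxE eq_sym (negbTE ji).
by rewrite big_nat_recr//= -addrA (le_trans _ IH)// lerD2l.
Qed.

(* Every visit to j is followed by a visit to l with probability P j l; so a
   bound propagates backwards along a path from a state where s > 0. *)
Lemma expected_visits_bounded j :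
  exists C, forall n i, \sum_(0 <= k < n) (P ^+ k) i j <= C.
Proof.
have [j' /connectP [c]] := P_abs j.
elim: c j => [|l c IH] j /=.
  move=> _ -> sj; exists (s j)^-1 => n i.
  rewrite -(ler_pM2r sj) mulVf ?gt_eqF// mulr_suml.
  apply: le_trans (expected_absorption n i); apply: ler_sum => k _.
  rewrite (bigD1 j)//= lerDl sumr_ge0// => l _.
  by rewrite mulr_ge0 ?expmx_ge0.
move=> /andP[jl lc] cE sj; have [C Cb] := IH l lc cE sj.
exists (C / P j l) => n i; rewrite ler_pdivlMr// mulr_suml.
apply: le_trans (Cb n.+1 i); rewrite big_nat_recl//.
rewrite -[leLHS]add0r lerD ?expmx_ge0//; apply: ler_sum => k _.
rewrite exprSr mxE (bigD1 j)//= lerDl sumr_ge0// => m _.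
by rewrite mulr_ge0 ?expmx_ge0.
Qed.

(** Taking the limit in [R] keeps matrix algebra available; it is a genuine limit by
    [is_cvg_expected_visits]. *)
Definition green : 'M[R]_N.+1 :=
  \matrix_(i, j) limn (fun n => \sum_(0 <= k < n) (P ^+ k) i j).

Lemma is_cvg_expected_visits i j :
  cvgn (fun n => \sum_(0 <= k < n) (P ^+ k) i j).
Proof.
apply: nondecreasing_is_cvgn.
  apply/nondecreasing_seqP => n.
  by rewrite big_nat_recr//= lerDl expmx_ge0.
have [C Cb] := expected_visits_bounded j.
by exists C => _ [n _ <-].
Qed.

Lemma green_cvg i j :
  ((fun n => \sum_(0 <= k < n) (P ^+ k) i j) @ \oo --> green i j)%classic.
Proof. by rewrite mxE; exact: is_cvg_expected_visits. Qed.

Lemma green_ge0 i j : 0 <= green i j.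
Proof.
rewrite mxE; apply: limr_ge; first exact: is_cvg_expected_visits.
by apply: nearW => n; rewrite sumr_ge0// => k _; exact: expmx_ge0.
Qed.

(** Splitting off the first step gives G = 1 + P G in the limit, so G is a right inverse of 1 - P.
    For square matrices it is then a left inverse, the side that acts on rows. *)
Lemma green_inv : green *m (1%:M - P) = 1%:M.
Proof.
apply: mulmx1C.
suff gE : green = 1%:M + P *m green.
  by rewrite mulmxBl mul1mx [X in X - _]gE addrK.
apply/matrixP => i j.
apply: (cvg_unique _ (@green_cvg i j)); first exact: norm_hausdorff.
(* The shifted partial sums always contain the term [k = 0], the identity matrix. *)
rewrite /= -cvg_shiftS /=; under eq_fun do rewrite big_nat_recl// expr0.
rewrite mxE; apply: cvgD; first exact: cvg_cst.
rewrite mxE.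
rewrite [X in (X @ _ --> _)%classic](_ : _ = fun n =>
    \sum_l P i l * \sum_(0 <= k < n) (P ^+ k) l j); last first.
  apply/funext => n; under eq_bigr do rewrite exprS mxE.
  by rewrite exchange_big; apply: eq_bigr => l _; rewrite mulr_sumr.
apply: cvg_big => [|l _]; first exact: add_continuous.
apply: cvgM; [exact: cvg_cst|exact: green_cvg].
Qed.

(** In G = 1 + G P all entries of G P are nonnegative. *)
Lemma green_diag_gt0 i : 0 < green i i.
Proof.
have /matrixP/(_ i i) := green_inv.
rewrite mulmxBr mulmx1 !mxE eqxx => /eqP; rewrite subr_eq => /eqP.
under eq_bigr => k _ do rewrite -/(green i k).
have -> : limn (fun n => \sum_(0 <= k < n) (P ^+ k) i i) = green i i.
  by rewrite mxE.
move=> ->; rewrite ltr_wpDr// sumr_ge0// => k _.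
by rewrite mulr_ge0 ?green_ge0.
Qed.

End Substochastic.

(** * Balance equations of the walk *)

Section Walk.
Variables (R : realType) (N : nat) (p q r s : int -> R).
Hypothesis walk : random_walk N p q r s.
Let P := step N p q r.

Lemma step_decomp (i j : 'I_N.+1) :
  P i j = (if i.+1 == j :> nat then p i%:Z else 0)
        + (if i == j :> nat then r i%:Z else 0)
        + (if i == j.+1 :> nat then q i%:Z else 0).
Proof.
rewrite /P mxE -(inj_eq val_inj) /= [j == _ :> nat]eq_sym [j.+1 == _]eq_sym.
by case: ifP; case: ifP; case: ifP; rewrite ?addr0 ?add0r //; lia.
Qed.

Lemma step_ge0 i j : 0 <= P i j.
Proof.
have iN : 0 <= i%:Z <= N%:Z by have := ltn_ord i; lia.
have [p0 q0 r0 _] := walk_ge0 walk iN.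
by rewrite step_decomp !addr_ge0//; case: ifP.
Qed.

Lemma step_row_sum i : \sum_j P i j + s i%:Z <= 1.
Proof.
have iN : 0 <= i%:Z <= N%:Z by have := ltn_ord i; lia.
have [p0 q0 r0 s0] := walk_ge0 walk iN.
rewrite -(walk_sum1 walk iN) lerD2r; under eq_bigr do rewrite step_decomp.
have sum_le (c : nat) (b : R) : 0 <= b ->
    \sum_(j < N.+1) (if c == j :> nat then b else 0) <= b.
  move=> b0; under eq_bigr do rewrite eq_sym.
  by rewrite -big_mkcond (big_ord1_eq _ (fun=> b)); case: ifP.
rewrite !big_split /= [leRHS]addrAC; apply: lerD.
  by apply: lerD; apply: sum_le.
case: (nat_of_ord i) q0 => [|i'] q0; last exact: sum_le.
by rewrite big1.
Qed.

(** The zeros of [w] at the artificial states replace the missing neighbours of 0 and [N], so one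
    formula covers all columns. *)
Lemma sum_step (w : int -> R) (j : 'I_N.+1) : w (- 1) = 0 -> w (N%:Z + 1) = 0 ->
  \sum_(i < N.+1) w i%:Z * P i j = p (j%:Z - 1) * w (j%:Z - 1) + r j%:Z * w j%:Z
    + q (j%:Z + 1) * w (j%:Z + 1).
Proof.
move=> wl wr; under eq_bigr do rewrite step_decomp !mulrDr.
have sum_eq (c : nat) (b : int -> R) :
    \sum_(i < N.+1) w i%:Z * (if i == c :> nat then b i%:Z else 0) =
    if (c < N.+1)%N then b c%:Z * w c%:Z else 0.
  rewrite -(big_ord1_eq +%R (fun i => b i%:Z * w i%:Z)) [RHS]big_mkcond.
  by apply: eq_bigr => i _; case: ifP; rewrite ?mulr0// mulrC.
rewrite !big_split /= !sum_eq ltn_ord; congr (_ + _ + _).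
  case: (nat_of_ord j) (ltn_ord j) => [_|j' jN].
    by rewrite sub0r wl mulr0 big1// => i _; rewrite mulr0.
  under eq_bigr do rewrite eqSS.
  by rewrite sum_eq ltnW// (_ : j'.+1%:Z - 1 = j'%:Z)//; lia.
have -> : j%:Z + 1 = j.+1%:Z by lia.
case: ifPn => // jN; suff -> : j.+1%:Z = N%:Z + 1 by rewrite wr mulr0.
by have := ltn_ord j; lia.
Qed.

Lemma step_absorbing i : exists2 j,
  connect [rel a b : 'I_N.+1 | 0 < P a b] i j & 0 < s j%:Z.
Proof. exact: walk_absorbing walk i. Qed.

Let s_ge0 (i : 'I_N.+1) : 0 <= s i%:Z.
Proof.
have iN : 0 <= i%:Z <= N%:Z by have := ltn_ord i; lia.
by have [] := walk_ge0 walk iN.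
Qed.

(** A real-valued form of [arrivals], open to field arithmetic; [arrivalsE] identifies the two. *)
Definition visits (i : 'I_N.+1) (j : int) : R :=
  if j is Posz n then if insub n is Some j' then green P i j' else 0 else 0.

Lemma visits_ord i (j : 'I_N.+1) : visits i j%:Z = green P i j.
Proof. by rewrite /visits valK. Qed.

Lemma visitsN1 i : visits i (- 1) = 0.
Proof. by []. Qed.

Lemma visitsSN i : visits i (N%:Z + 1) = 0.
Proof.
rewrite (_ : N%:Z + 1 = N.+1%:Z); last by lia.
by rewrite /visits insubF// ltnn.
Qed.

Lemma arrivalsE i j : arrivals p q r i j = (visits i j)%:E.
Proof.
case: j => // n; rewrite /visits/arrivals.
case: insubP => // j _ _.
under eq_fun do rewrite sumEFin.
rewrite EFin_lim ?mxE//.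
exact: (is_cvg_expected_visits step_ge0 s_ge0 step_row_sum step_absorbing).
Qed.

Lemma visits_balance (i : 'I_N.+1) (j : int) : 0 <= j <= N%:Z ->
  visits i j = (i%:Z == j)%:R + p (j - 1) * visits i (j - 1)
    + r j * visits i j + q (j + 1) * visits i (j + 1).
Proof.
case: j => // j jN; have {}jN : (j < N.+1)%N by lia.
have /eqP := green_inv step_ge0 s_ge0 step_row_sum step_absorbing.
rewrite mulmxBr mulmx1 subr_eq => /eqP/matrixP/(_ i (Ordinal jN)).
rewrite [RHS]mxE [X in _ + X]mxE -visits_ord.
under eq_bigr do rewrite -visits_ord.
rewrite sum_step ?visitsSN// !addrA mxE; apply.
Qed.

(** As a row, [w] satisfies w (1 - P) = c e_i; multiplying by G on the right gives c times row [i]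
    of G. *)
Lemma balance_unique (i : 'I_N.+1) (w : int -> R) (c : R) :
  w (- 1) = 0 -> w (N%:Z + 1) = 0 ->
  (forall j : int, 0 <= j <= N%:Z ->
     w j = c * (i%:Z == j)%:R + p (j - 1) * w (j - 1) + r j * w j
           + q (j + 1) * w (j + 1)) ->
  forall j : int, 0 <= j <= N%:Z -> w j = c * visits i j.
Proof.
move=> wl wr wE [] // j jN; have {}jN : (j < N.+1)%N by lia.
pose v : 'rV[R]_N.+1 := \row_j w j%:Z.
have vE : v *m (1%:M - P) = c *: delta_mx 0 i.
  apply/rowP => k; rewrite mulmxBr mulmx1 !mxE.
  under eq_bigr do rewrite mxE.
  rewrite sum_step// [X in X - _]wE; last by have := ltn_ord k; lia.
  rewrite eqxx /= (_ : (k == i) = (i%:Z == k%:Z)); first by ring.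
  by rewrite eq_sym.
have vG : v = c *: row i (green P).
  rewrite rowE scalemxAl -vE -mulmxA.
  rewrite (mulmx1C (green_inv step_ge0 s_ge0 step_row_sum step_absorbing)).
  by rewrite mulmx1.
have /rowP/(_ (Ordinal jN)) := vG.
by rewrite -[j]/(val (Ordinal jN)) visits_ord !mxE.
Qed.

Lemma visits_gt0 (i : 'I_N.+1) : 0 < visits i i%:Z.
Proof.
rewrite visits_ord.
exact: green_diag_gt0 step_ge0 s_ge0 step_row_sum step_absorbing i.
Qed.

(** Since G_ii > 0, a zero of [w] at the source forces [c = 0]. *)
Lemma balance_eq0 (i : 'I_N.+1) (w : int -> R) (c : R) (a : int) :
  w (- 1) = 0 -> w (N%:Z + 1) = 0 ->
  (forall j : int, 0 <= j <= N%:Z ->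
     w j = c * (i%:Z == j)%:R + p (j - 1) * w (j - 1) + r j * w j
           + q (j + 1) * w (j + 1)) ->
  w i%:Z = 0 -> 0 <= a <= N%:Z -> w a = 0.
Proof.
move=> wl wr wE wi aN; have wV := balance_unique wl wr wE.
have iN : 0 <= i%:Z <= N%:Z by have := ltn_ord i; lia.
move: wi; rewrite wV// => /eqP; rewrite mulf_eq0 (gt_eqF (visits_gt0 i)) orbF.
by move=> /eqP c0; rewrite wV// c0 mul0r.
Qed.

(** * Nonvanishing of the denominators *)

Lemma A_lt0 (lam mu : int -> R) (m j : int) : j < 0 -> A lam mu m j = 0.
Proof. by case: j. Qed.

Lemma A_above_neq0 (i : 'I_N.+1) : (i < N)%N ->
  (forall j : int, i%:Z + 2 <= j <= N%:Z + 1 -> 0 < q j) ->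
  A (lambda_ q r) (mu_ p q) (i%:Z + 1) (N%:Z - i%:Z) != 0.
Proof.
move=> iN q0; apply/eqP => AN.
pose w (j : int) := A (lambda_ q r) (mu_ p q) (i%:Z + 1) (j - i%:Z - 1).
(* The value 0 of [A] at every negative index extends [w] by zero to the source and everything left
   of it. *)
have w0 (j : int) : j <= i%:Z -> w j = 0 by move=> ji; rewrite /w A_lt0//; lia.
have wi1 : w (i%:Z + 1) = 1 by rewrite /w (_ : _ - 1 = 0)//; lia.
suff : w (i%:Z + 1) = 0 by rewrite wi1 => /eqP; rewrite oner_eq0.
(* Balance at the source reads 0 = c + q_(i+1) w_(i+1) with w_(i+1) = 1, which dictates c. *)
apply: (@balance_eq0 i w (- q (i%:Z + 1))).
- by apply: w0; lia.
- by rewrite /w -[RHS]AN; congr (A _ _ _ _); lia.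
- move=> j jN; case: (ltgtP j i%:Z) => ji.
  + by rewrite !w0 ?mulr0 ?addr0 //; lia.
  + have qj : 0 < q (j + 1) by apply: q0; lia.
    have -> : w (j + 1) = lambda_ q r j * w j + mu_ p q (j - 1) * w (j - 1).
      rewrite {1}/w (_ : j + 1 - _ - _ = j - i%:Z - 1 + 1); last by lia.
      rewrite A_rec; last by lia.
      by congr (lambda_ _ _ _ * _ + mu_ _ _ _ * A _ _ _ _); lia.
    rewrite /lambda_ /mu_ (_ : j - 1 + 2 = j + 1); last by lia.
    by rewrite mulr0 add0r; field; rewrite gt_eqF.
  + by rewrite ji wi1 (w0 (i%:Z - 1)) ?w0//; [rewrite mulr1n; ring|lia].
- exact: w0.
- by lia.
Qed.

(** Mirror image of [A_above_neq0]: [w] lives to the left of [i], and the source has strength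
    -p_(i-1). *)
Lemma A_below_neq0 (i : 'I_N.+1) : (0 < i)%N ->
  (forall j : int, - 1 <= j <= i%:Z - 2 -> 0 < p j) ->
  A (rho_ p r) (theta_ p q) (1 - i%:Z) i%:Z != 0.
Proof.
move=> i0 p0; apply/eqP => AN; have := ltn_ord i => iN.
pose w (j : int) := A (rho_ p r) (theta_ p q) (1 - i%:Z) (i%:Z - 1 - j).
have w0 (j : int) : i%:Z <= j -> w j = 0 by move=> ji; rewrite /w A_lt0//; lia.
have wi1 : w (i%:Z - 1) = 1 by rewrite /w subrr.
suff : w (i%:Z - 1) = 0 by rewrite wi1 => /eqP; rewrite oner_eq0.
apply: (@balance_eq0 i w (- p (i%:Z - 1))).
- by rewrite /w -[RHS]AN; congr (A _ _ _ _); lia.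
- by apply: w0; lia.
- move=> j jN; case: (ltgtP j i%:Z) => ji.
  + have pj : 0 < p (j - 1) by apply: p0; lia.
    have -> : w (j - 1) =
        rho_ p r (- j) * w j + theta_ p q (- (j + 1)) * w (j + 1).
      rewrite {1}/w (_ : i%:Z - 1 - _ = i%:Z - 1 - j + 1); last by lia.
      rewrite A_rec; last by lia.
      by congr (rho_ _ _ _ * _ + theta_ _ _ _ * A _ _ _ _); lia.
    rewrite /rho_ /theta_ !opprK (_ : j + 1 - 2 = j - 1); last by lia.
    by rewrite mulr0 add0r; field; rewrite gt_eqF.
  + by rewrite !w0 ?mulr0 ?addr0 //; lia.
  + by rewrite ji wi1 (w0 (i%:Z + 1)) ?w0//; [rewrite mulr1n; ring|lia].
- exact: w0.
- by lia.
Qed.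

(** If it vanished, [A] with upper index 0 would be balanced everywhere without a source, hence
    zero, although it is 1 at state 0. *)
Lemma A_full_neq0 :
  (forall j : int, 1 <= j <= N%:Z + 1 -> 0 < q j) ->
  A (lambda_ q r) (mu_ p q) 0 (N%:Z + 1) != 0.
Proof.
move=> q0; apply/eqP => AN.
suff : A (lambda_ q r) (mu_ p q) 0 0 = 0 * visits ord0 0.
  by rewrite mul0r => /eqP; rewrite oner_eq0.
apply: balance_unique => // j jN.
have qj : 0 < q (j + 1) by apply: q0; lia.
rewrite A_rec; last by lia.
rewrite !add0r /lambda_ /mu_ (_ : j - 1 + 2 = j + 1); last by lia.
by field; rewrite gt_eqF.
Qed.

(** * Expected visits on each side of the start *)

Lemma visits_recr (i : 'I_N.+1) (j : int) :
  0 <= j <= N%:Z -> i%:Z != j -> q (j + 1) != 0 ->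
  visits i (j + 1) = lambda_ q r j * visits i j
                     + mu_ p q (j - 1) * visits i (j - 1).
Proof.
move=> jN /negbTE ij qj; have := visits_balance i jN.
rewrite ij add0r /lambda_ /mu_ (_ : j - 1 + 2 = j + 1); last by lia.
move=> vE; apply: (mulfI qj); rewrite mulrDr.
have -> : q (j + 1) * visits i (j + 1) =
  visits i j - (p (j - 1) * visits i (j - 1) + r j * visits i j).
  by rewrite {1}vE; ring.
by field.
Qed.

Lemma visits_recl (i : 'I_N.+1) (j : int) :
  0 <= j <= N%:Z -> i%:Z != j -> p (j - 1) != 0 ->
  visits i (j - 1) = rho_ p r (- j) * visits i j
                     + theta_ p q (- (j + 1)) * visits i (j + 1).
Proof.
move=> jN /negbTE ij pj; have := visits_balance i jN.
rewrite ij add0r /rho_ /theta_ !opprK (_ : j + 1 - 2 = j - 1); last by lia.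
move=> vE; apply: (mulfI pj); rewrite mulrDr.
have -> : p (j - 1) * visits i (j - 1) =
  visits i j - (r j * visits i j + q (j + 1) * visits i (j + 1)).
  by rewrite {1}vE; ring.
by field.
Qed.

Lemma visits_above (i : 'I_N.+1) : (i < N)%N ->
  (forall j : int, i%:Z + 2 <= j <= N%:Z + 1 -> 0 < q j) ->
  let mu := mu_ p q in
  let AL := A (lambda_ q r) mu in
  forall k : nat, (k <= N - i)%N ->
    visits i (i%:Z + k%:Z + 1) = mu i%:Z * visits i i%:Z *
      ((AL (i%:Z + 2) (k%:Z - 1) * AL (i%:Z + 1) (N%:Z - i%:Z)
        - AL (i%:Z + 2) (N%:Z - i%:Z - 1) * AL (i%:Z + 1) k%:Z)
       / AL (i%:Z + 1) (N%:Z - i%:Z)).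
Proof.
move=> iN q0 mu AL k kN; have AN := A_above_neq0 iN q0.
have NE : (N - i)%N%:Z = N%:Z - i%:Z by lia.
(* Reading rightwards from the source, the balance equations at i+1, ..., N form a recurrence of
   index i+1 that ends with the zero at N+1. *)
pose y n := visits i (i%:Z + n%:Z).
have yrec n : (n < N - i)%N -> y n.+2 = lambda_ q r (i%:Z + 1 + n%:Z) * y n.+1
    + mu (i%:Z + 1 + n%:Z - 1) * y n.
  move=> nN; rewrite /y (_ : i%:Z + n.+2%:Z = i%:Z + n.+1%:Z + 1); last by lia.
  rewrite visits_recr; [|lia|lia|rewrite gt_eqF// q0//; lia].
  by congr (lambda_ _ _ _ * _ + mu _ * visits _ _); lia.
have yN : y (N - i).+1 = 0.
  by rewrite /y (_ : _ + _ = N%:Z + 1) ?visitsSN//; lia.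
have := linear_recurrence_bvp yrec yN; rewrite NE => /(_ AN k kN).
rewrite /y addrK addr0 (_ : i%:Z + 1 + 1 = i%:Z + 2); last by lia.
by move=> <-; congr (visits _ _); lia.
Qed.

Lemma visits_below (i : 'I_N.+1) : (0 < i)%N ->
  (forall j : int, - 1 <= j <= i%:Z - 2 -> 0 < p j) ->
  let theta := theta_ p q in
  let AR := A (rho_ p r) theta in
  forall k : nat, (k <= i)%N ->
    visits i (i%:Z - (k%:Z + 1)) = theta (- i%:Z) * visits i i%:Z *
      ((AR (2 - i%:Z) (k%:Z - 1) * AR (1 - i%:Z) i%:Z
        - AR (2 - i%:Z) (i%:Z - 1) * AR (1 - i%:Z) k%:Z)
       / AR (1 - i%:Z) i%:Z).
Proof.
move=> i0 p0 theta AR k ki; have AN := A_below_neq0 i0 p0.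
have := ltn_ord i => iN.
(* Reading leftwards, state i-1 has index 1-i in [rho_], and the terminal zero lies at -1. *)
pose y n := visits i (i%:Z - n%:Z).
have yrec n : (n < i)%N -> y n.+2 = rho_ p r (1 - i%:Z + n%:Z) * y n.+1
    + theta (1 - i%:Z + n%:Z - 1) * y n.
  move=> ni; rewrite /y (_ : i%:Z - n.+2%:Z = i%:Z - n.+1%:Z - 1); last by lia.
  rewrite visits_recl; [|lia|lia|rewrite gt_eqF// p0//; lia].
  by congr (rho_ _ _ _ * _ + theta _ * visits _ _); lia.
have yi : y i.+1 = 0 by rewrite /y (_ : _ - _ = - 1) ?visitsN1//; lia.
have := linear_recurrence_bvp yrec yi AN ki.
rewrite /y subr0 (_ : 1 - i%:Z - 1 = - i%:Z); last by lia.
rewrite (_ : 1 - i%:Z + 1 = 2 - i%:Z); last by lia.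
by move=> <-; congr (visits _ _); lia.
Qed.

(** Here the source equation itself supplies the first neighbour, lambda_0 x_0 - 1/q_1; [A_recl]
    then collects the terms in x_0. *)
Lemma visits_from0 (k : nat) :
  (forall j : int, 1 <= j <= N%:Z + 1 -> 0 < q j) -> (k <= N)%N ->
  let AL := A (lambda_ q r) (mu_ p q) in
  visits ord0 k.+1%:Z = AL 0 k.+1%:Z * visits ord0 0 - AL 1 k%:Z / q 1.
Proof.
move=> q0 kN AL; have q1 : q 1 != 0 by rewrite gt_eqF// q0//; lia.
pose y n := visits ord0 n%:Z.
have yrec n : (n < N)%N -> y n.+2 = lambda_ q r (1 + n%:Z) * y n.+1
    + mu_ p q (1 + n%:Z - 1) * y n.
  move=> nN; rewrite /y (_ : n.+2%:Z = n.+1%:Z + 1); last by lia.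
  rewrite visits_recr; [|lia|by []|rewrite gt_eqF// q0//; lia].
  by congr (lambda_ _ _ _ * _ + mu_ _ _ _ * visits _ _); lia.
have y1 : y 1%N = lambda_ q r 0 * y 0%N - 1 / q 1.
  have := @visits_balance ord0 0 isT.
  rewrite eqxx sub0r visitsN1 mulr0 addr0 !add0r mulr1n.
  rewrite -/(y 0%N) -/(y 1%N) => vE.
  apply: (mulfI q1); have -> : q 1 * y 1%N = y 0%N - (1 + r 0 * y 0%N).
    by rewrite {1}vE; ring.
  by rewrite /lambda_ add0r; field.
rewrite -/(y k.+1) (linear_recurrence_sol yrec kN) y1 /AL A_recl.
rewrite !add0r -/(y 0%N).
have -> : 1 - 1 = 0 :> int by [].
have -> : 1 + 1 = 2 :> int by [].
by ring.
Qed.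

End Walk.

(** * Value at the start and final formulas *)

Theorem theorem3p3 (R : realType) (N : nat) (p q r s : int -> R)
    (i0 : 'I_N.+1) (walk : random_walk N p q r s) :
  let i := i0%:Z in
  let x := arrivals p q r i0 in
  let mu := mu_ p q in
  let theta := theta_ p q in
  let AL := A (lambda_ q r) mu in
  let AR := A (rho_ p r) theta in
  ((0 < i0 < N)%N ->
   0 < q (N%:Z + 1) -> 0 < p (- 1) ->
   (forall j : int, i + 2 <= j <= N%:Z -> 0 < q j) ->
   (forall j : int, 0 <= j <= i - 2 -> 0 < p j) ->
   [/\ x i = ((1 - r i
               + p (i - 1) * theta (- i) * (AR (2 - i) (i - 1) / AR (1 - i) i)
               + q (i + 1) * mu i
                 * (AL (i + 2) (N%:Z - i - 1) / AL (i + 1) (N%:Z - i)))^-1)%:E,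
       forall k : nat, (k <= N - i0)%N ->
         x (i + k%:Z + 1) =
         ((mu i)%:E * x i *
          ((AL (i + 2) (k%:Z - 1) * AL (i + 1) (N%:Z - i)
            - AL (i + 2) (N%:Z - i - 1) * AL (i + 1) k%:Z)
           / AL (i + 1) (N%:Z - i))%:E)%E &
       forall k : nat, (k <= i0 - 1)%N ->
         x (i - (k%:Z + 1)) =
         ((theta (- i))%:E * x i *
          ((AR (2 - i) (k%:Z - 1) * AR (1 - i) i
            - AR (2 - i) (i - 1) * AR (1 - i) k%:Z)
           / AR (1 - i) i)%:E)%E]) /\
  (i0 = 0%N :> nat ->
   0 < q (N%:Z + 1) ->
   (forall j : int, 1 <= j <= N%:Z -> 0 < q j) ->
   x 0 = (AL 1 N%:Z / (q 1 * AL 0 (N%:Z + 1)))%:E /\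
   forall k : nat, (1 <= k <= N)%N ->
     x k%:Z = ((AL 1 N%:Z * AL 0 k%:Z - AL 1 (k%:Z - 1) * AL 0 (N%:Z + 1))
               / (q 1 * AL 0 (N%:Z + 1)))%:E).
Proof.
move=> i x mu theta AL AR; split.
  move=> /andP[i_gt0 iN] qN p1 q0 p0.
  have q0' (j : int) : i + 2 <= j <= N%:Z + 1 -> 0 < q j.
    move=> /andP[ij]; rewrite le_eqVlt => /orP[/eqP->//|jN].
    by apply: q0; rewrite ij/=; lia.
  have p0' (j : int) : - 1 <= j <= i - 2 -> 0 < p j.
    move=> /andP[]; rewrite le_eqVlt => /orP[/eqP<-//|j0 ji].
    by apply: p0; rewrite ji andbT; lia.
  have above := visits_above walk iN q0'.
  have below := visits_below walk i_gt0 p0'.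
  split=> [|k kN|k ki].
  - rewrite /x (arrivalsE walk); congr _%:E.
    set D := (X in X^-1); set v := visits _ _ _ _ i.
    (* At [k = 0] the bracket keeps only one product, because A_(-1) = 0 and A_0 = 1. *)
    have v_above : visits p q r i0 (i + 1) =
        - (mu i * v * (AL (i + 2) (N%:Z - i - 1) / AL (i + 1) (N%:Z - i))).
      have := above 0%N (leq0n _); rewrite addr0 -/i -/v -/mu -/AL => ->.
      have -> : AL (i + 2) (0%N%:Z - 1) = 0 by [].
      have -> : AL (i + 1) 0%N%:Z = 1 by [].
      by ring.
    have v_below : visits p q r i0 (i - 1) =
        - (theta (- i) * v * (AR (2 - i) (i - 1) / AR (1 - i) i)).
      have := below 0%N (leq0n _); rewrite add0r -/i -/v -/theta -/AR => ->.
      have -> : AR (2 - i) (0%N%:Z - 1) = 0 by [].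
      have -> : AR (1 - i) 0%N%:Z = 1 by [].
      by ring.
    (* This is the balance equation at the source with both neighbours written as multiples of [v];
       it also shows that [D] is nonzero. *)
    have vD : v * D = 1.
      have iN' : 0 <= i <= N%:Z by rewrite /i; lia.
      have /eqP := visits_balance walk i0 iN'.
      rewrite eqxx v_above v_below -/v mulr1n -subr_eq0 => /eqP vE.
      by apply/subr0_eq; rewrite -[RHS]vE /D; ring.
    have D0 : D != 0.
      by apply: contra_eq_neq vD => ->; rewrite mulr0 eq_sym oner_eq0.
    by apply: (mulIf D0); rewrite mulVf.
  - by rewrite /x !(arrivalsE walk) above.
  - by rewrite /x !(arrivalsE walk) below//; lia.
move=> i_eq0 qN q0.
have q0' (j : int) : 1 <= j <= N%:Z + 1 -> 0 < q j.
  move=> /andP[j1]; rewrite le_eqVlt => /orP[/eqP->//|jN].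
  by apply: q0; rewrite j1/=; lia.
have AN : AL 0 (N%:Z + 1) != 0 by exact: A_full_neq0 walk q0'.
have q1 : q 1 != 0 by rewrite gt_eqF// q0'//; lia.
have i0E : i0 = ord0 by exact/val_inj.
have NE : N.+1%:Z = N%:Z + 1 by lia.
(* The case [k = N] of [visits_from0], where the left side is the zero at N+1, determines x_0. *)
have v0 : visits p q r i0 0 = AL 1 N%:Z / (q 1 * AL 0 (N%:Z + 1)).
  have := visits_from0 walk q0' (leqnn N).
  rewrite NE visitsSN => /eqP; rewrite eq_sym subr_eq0 i0E => /eqP vE.
  by apply: (mulfI AN); rewrite vE -/mu -/AL; field; rewrite AN.
split=> [|[//|k] kN]; rewrite /x (arrivalsE walk) ?v0//; congr _%:E.
rewrite i0E (visits_from0 walk q0')//; last by lia.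
rewrite -i0E v0 (_ : k.+1%:Z - 1 = k%:Z); last by lia.
by rewrite -/mu -/AL; field; rewrite AN.
Qed.
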